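(* For all integers $d\ge 3$ and $n\ge d+3$, $$M_d(n)\ \ge\ \binom{n-1}{d}+\binom{n-4}{d-2}+\binom{n-6}{d-3}.$$ In particular, for every $d\ge 3$ and every $n\ge 2d+2$, the value $\binom{n-1}{d}+\binom{n-4}{d-2}$ is not optimal, i.e. $M_d(n)>\binom{n-1}{d}+\binom{n-4}{d-2}$.
   Context: For a finite set $X$, a family $\mathcal{F}\subseteq 2^X$ and a set $S\subseteq X$, the trace of $\mathcal{F}$ on $S$ is $\operatorname{Tr}_{\mathcal{F}}(S)=\{F\cap S: F\in\mathcal{F}\}$. The set $S$ is shattered by $\mathcal{F}$ if $\operatorname{Tr}_{\mathcal{F}}(S)=2^S$, and the VC-dimension $\operatorname{VC}(\mathcal{F})$ is the maximum size of a set shattered by $\mathcal{F}$. Write $[n]=\{1,\dots,n\}$ and let $\binom{X}{r}$ denote the set of all $r$-element subsets of $X$. For integers $d\ge 0$ and $n\ge d+1$ define $$M_d(n)=\max\left\{|\mathcal{F}| : \mathcal{F}\subseteq\binom{[n]}{d+1},\ \operatorname{VC}(\mathcal{F})\le d\right\}.$$ Convention: the numerical binomial coefficient $\binom{m}{r}$ is $0$ if $r<0$ or $r>m$. *)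

(* Defs.v *)
From mathcomp Require Import all_boot.

Set Implicit Arguments.
Unset Strict Implicit.
Unset Printing Implicit Defensive.

Definition trace (T : finType) (F : {set {set T}}) (S : {set T}) : {set {set T}} :=
  [set A :&: S | A in F].

Definition shattered (T : finType) (F : {set {set T}}) (S : {set T}) : bool :=
  trace F S == powerset S.

(* The empty family shatters no set at all; its VC-dimension is 0 here (the
   value of the empty maximum). *)
Definition VCdim (T : finType) (F : {set {set T}}) : nat :=
  \max_(S : {set T} | shattered F S) #|S|.

Definition subsets_of_card (T : finType) (r : nat) : {set {set T}} :=
  [set A : {set T} | #|A| == r].

(* The ground set {1, ..., n} is represented by 'I_n = {0, ..., n - 1}.  The
   maximum ranges over a nonempty collection (it contains the empty family), so
   it is attained. *)
Definition M (d n : nat) : nat :=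
  \max_(F : {set {set 'I_n}} |
        (F \subset subsets_of_card 'I_n d.+1) && (VCdim F <= d)) #|F|.

(* Main.v *)
Require Import Defs.
From mathcomp Require Import all_boot.
From mathcomp Require Import zify.

Set Implicit Arguments.
Unset Strict Implicit.
Unset Printing Implicit Defensive.

(** Fix six points p_0, ..., p_5 of the ground set and let a (d+1)-set A belong
    to the family F exactly when its pattern, the set of those i with p_i in A,
    lies in a fixed list of subsets of {0, ..., 5}. Both the size of F and its
    VC-dimension are then governed by that list alone.

    Size: a pattern with w elements is realised by C(n-6, d+1-w) sets. The list
    has 1, 5, 11, 13, 6, 1 patterns with 1, ..., 6 elements, and three uses of
    the Vandermonde identity turn the resulting sum into the claimed bound:
    C(n-1, d) accounts for 1, 5, 10, 10, 5, 1 (the patterns of a full star),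
    C(n-4, d-2) for 1, 2, 1 in weights 3, 4, 5, and C(n-6, d-3) for one more
    pattern of weight 4.

    VC-dimension: a shattered (d+1)-set S is itself in F, since S is one of its
    own traces. Let t be its pattern and R its part outside the six points, so
    that |R| = d+1-|t|. A member of F with trace c u R on S, where c is a subset
    of t, contains R and so has a pattern u with u n t = c and at most |t|
    elements. Hence S is not shattered as soon as some subset c of t is the trace
    on t of no listed pattern u with |u| <= |t|. This condition, deficient below,
    mentions neither n nor d, and for 37 patterns on six points it is a finite
    computation ([six_point_patterns_deficient]).

    The list perturbs a smaller one. Patterns on {0, 1, 2, 3} alone, namely {0},
    {0,1}, {0,2}, {1,3} and everything with at least three elements, are already
    deficient and give C(n-1, d) + C(n-4, d-2). Lifted to six points, they have
    1, 5, 11, 12, 6, 1 members by weight. Exchanging {0,4,5} for {1,4,5} makes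
    room for one more 4-element pattern: {0,3,4,5} and {2,3,4,5} come in and only
    {0,2,4,5} goes out. *)

Definition weight (t : bitseq) : nat := count id t.

(** Patterns are bit sequences rather than finite sets, so that statements about
    them can be decided by evaluation. *)
Definition meet (t u : bitseq) : bitseq := [seq p.1 && p.2 | p <- zip t u].

(** The condition that keeps a family given by patterns from shattering one of
    its members: the trace [meet c t] is missing from the traces on [t] left by
    patterns no heavier than [t]. Heavier patterns are harmless, because a
    member with such a pattern has too few elements left to contain the rest of
    the set to be shattered. *)
Definition deficient (ts : seq bitseq) : Prop :=
  forall t, t \in ts -> exists2 c, size c = size t &
    forall u, u \in ts -> meet u t = meet c t -> weight t < weight u.

Section Patterns.

Variables (T : finType) (ps : seq T).
Hypothesis ps_uniq : uniq ps.

Definition pattern (A : {set T}) : bitseq := [seq x \in A | x <- ps].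

Definition family (ts : seq bitseq) (r : nat) : {set {set T}} :=
  [set A | (pattern A \in ts) && (#|A| == r)].

Let K : {set T} := [set x in ps].

Lemma size_pattern A : size (pattern A) = size ps.
Proof. by rewrite size_map. Qed.

Lemma pattern_setI A B : pattern (A :&: B) = meet (pattern A) (pattern B).
Proof.
rewrite /pattern /meet zip_map -map_comp.
by apply: eq_map => x /=; rewrite inE.
Qed.

Lemma weight_pattern A : weight (pattern A) = #|A :&: K|.
Proof.
rewrite /weight /pattern count_map -size_filter.
rewrite -(card_uniqP (filter_uniq _ ps_uniq)).
by apply: eq_card => x; rewrite mem_filter !inE.
Qed.

(** Every bit sequence is a pattern, and points off the list [ps] do not affect
    it; this is used both to build the omitted trace and to count the members
    with a given pattern. *)
Lemma pattern_mask t (X : {set T}) :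
  size t = size ps -> X \subset ~: K -> pattern ([set x in mask t ps] :|: X) = t.
Proof.
move=> st XK; apply: (@eq_from_nth _ false); rewrite size_pattern // => i lti.
have [x0 _] : exists x0 : T, True by case: ps lti => // x; exists x.
rewrite (nth_map x0) // !inE in_mask // mem_nth // index_uniq //=.
have -> : nth x0 ps i \in X = false; last by rewrite orbF.
by apply/negP => /(subsetP XK); rewrite !inE mem_nth.
Qed.

(** The omitted trace on a member [S] consists of a deficient choice of points
    of the list together with all of [S] off the list. A member [A] with this
    trace contains [S] off the list and, by deficiency, has strictly more points
    than [S] on the list, so it would have more than [d.+1] elements. *)
Lemma VCdim_family ts d : deficient ts -> VCdim (family ts d.+1) <= d.
Proof.
move=> ts_def; apply/bigmax_leqP => S /eqP shS; rewrite leqNgt; apply/negP => dS.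
have traceP (B : {set T}) : B \subset S ->
    exists2 A, A \in family ts d.+1 & B = A :&: S.
  by rewrite -powersetE -shS => /imsetP.
(* The trace [S] of [S] comes from some [A] containing [S], and |A| <= |S|. *)
have SF : S \in family ts d.+1.
  have [A AF /esym/setIidPr SA] := traceP S (subxx S).
  have -> // : S = A.
  apply/eqP; rewrite eqEcard SA; move: AF.
  by rewrite inE => /andP[_ /eqP->].
have [St /eqP cS] : pattern S \in ts /\ #|S| == d.+1.
  by apply/andP; move: SF; rewrite inE.
have [c sc c_low] := ts_def _ St; rewrite size_pattern in sc.
pose C := [set x in mask c ps] :|: ~: K.
have [A AF eCA] := traceP (C :&: S) (subsetIr _ _).
have [At /eqP cA] : pattern A \in ts /\ #|A| == d.+1.
  by apply/andP; move: AF; rewrite inE.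
have wSA : weight (pattern S) < weight (pattern A).
  apply: c_low => //; rewrite -pattern_setI -eCA pattern_setI.
  by rewrite [pattern C]pattern_mask.
have SA : S :\: K \subset A :\: K.
  apply/subsetP => x /setDP[xS xK]; rewrite inE xK.
  have : x \in C :&: S by rewrite !inE xS; move: xK; rewrite inE => ->; rewrite orbT.
  by rewrite eCA => /setIP[].
have := subset_leq_card SA.
have := cardsID K S; have := cardsID K A.
by rewrite !weight_pattern in wSA; lia.
Qed.

(** Members with pattern [t] arise by adding to the points selected by [t] any
    set of the right size off the list. *)
Lemma card_fiber_ge t r : size t = size ps -> weight t <= r ->
  'C(#|T| - size ps, r - weight t) <= #|family [:: t] r|.
Proof.
move=> st wt.
have cK : #|~: K| = #|T| - size ps.
  have -> : size ps = #|K| by rewrite cardsE (card_uniqP ps_uniq).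
  by rewrite cardsCs setCK.
rewrite -cK -cards_draws.
pose Y := [set x in mask t ps].
have YK : Y \subset K.
  by apply/subsetP => x; rewrite !inE; apply: mem_mask.
have cY : #|Y| = weight t.
  by rewrite cardsE (card_uniqP (mask_uniq ps_uniq _)) size_mask.
rewrite -(@card_in_imset _ _ (setU Y)).
  apply/subset_leq_card/subsetP => _ /imsetP[X /[!inE] /andP[XK /eqP cX] ->].
  rewrite pattern_mask // eqxx /= cardsU cX cY.
  have -> : Y :&: X = set0.
    by apply/disjoint_setI0; rewrite disjoint_sym disjoints_subset (subset_trans XK) ?setCS.
  by rewrite cards0 subn0 subnKC.
apply: (can_in_inj (g := fun Z => Z :&: ~: K)) => X /[!inE] /andP[XK _].
rewrite setIUl (setIidPl XK).
have -> : Y :&: ~: K = set0 by apply/eqP; rewrite -setDE setD_eq0.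
exact: set0U.
Qed.

(** The restriction on weights matters: for [weight t > r] the truncated
    subtraction would contribute a spurious binomial coefficient equal to 1. *)
Lemma card_family_ge ts r : uniq ts -> all (fun t => size t == size ps) ts ->
  \sum_(t <- ts | weight t <= r) 'C(#|T| - size ps, r - weight t)
    <= #|family ts r|.
Proof.
elim: ts => [|t ts IH]; first by rewrite big_nil.
move=> /andP[t_ts uts] /andP[/eqP st sts]; rewrite big_cons.
have -> : family (t :: ts) r = family [:: t] r :|: family ts r.
  by apply/setP => A; rewrite !inE -andb_orl.
rewrite cardsU.
have -> : family [:: t] r :&: family ts r = set0.
  apply/setP => A; rewrite !inE; apply/negP => /andP[/andP[/eqP-> _]].
  by rewrite (negPf t_ts).
rewrite cards0 subn0.
case: ifP => wt; last by apply: leq_trans (IH uts sts) (leq_addl _ _).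
by rewrite leq_add ?card_fiber_ge ?IH.
Qed.

End Patterns.

Fixpoint cube (k : nat) : seq bitseq :=
  if k is k'.+1 then [seq b :: t | b <- [:: true; false], t <- cube k'] else [:: [::]].

Definition bits (s : seq nat) : bitseq := [seq i \in s | i <- iota 0 6].

(** Up to weight 3, the patterns whose trace on {0, 1, 2, 3} is {0}, {0,1},
    {0,2}, {1,3} or has three elements, with {0,4,5} replaced by {1,4,5}; above
    that, everything except {0,2,4,5} and {1,2,4,5}. *)
Definition six_point_patterns : seq bitseq :=
  [seq bits s | s <- [:: [:: 0];
    [:: 0; 1]; [:: 0; 2]; [:: 0; 4]; [:: 0; 5]; [:: 1; 3];
    [:: 0; 1; 2]; [:: 0; 1; 3]; [:: 0; 2; 3]; [:: 1; 2; 3];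
    [:: 0; 1; 4]; [:: 0; 2; 4]; [:: 1; 3; 4];
    [:: 0; 1; 5]; [:: 0; 2; 5]; [:: 1; 3; 5]; [:: 1; 4; 5]]] ++
  [seq t <- cube 6 |
     (4 <= weight t) && (t \notin [:: bits [:: 0; 2; 4; 5]; bits [:: 1; 2; 4; 5]])].

Lemma size_cube k c : c \in cube k -> size c = k.
Proof.
by elim: k c => [|k IH] c; [rewrite inE => /eqP-> | case/allpairsP=> -[b t] /= [_ /IH <- ->]].
Qed.

Lemma six_point_patterns_deficient : deficient six_point_patterns.
Proof.
have /allP deficientP : all (fun t => has (fun c => (size c == size t) &&
    all (fun u => (meet u t == meet c t) ==> (weight t < weight u)) six_point_patterns)
  (cube 6)) six_point_patterns by vm_compute.
move=> t /deficientP/hasP[c _ /andP[/eqP sc /allP c_low]].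
by exists c => // u /c_low/implyP c_lowu /eqP.
Qed.

(** Vandermonde for the weight distribution 1, 5, 11, 13, 6, 1, obtained by
    iterating Pascal's rule. *)
Lemma sum_six_point_patterns m d : 3 <= d ->
  \sum_(t <- six_point_patterns | weight t <= d.+1) 'C(m, d.+1 - weight t)
    = 'C(m + 5, d) + 'C(m + 2, d - 2) + 'C(m, d - 3).
Proof.
move=> d3.
rewrite -(big_map weight (fun w => w <= d.+1) (fun w => 'C(m, d.+1 - w))).
rewrite (perm_big (nseq 1 1 ++ nseq 5 2 ++ nseq 11 3 ++ nseq 13 4 ++ nseq 6 5
  ++ nseq 1 6)); last by vm_compute.
rewrite !big_cat !big_nseq_cond !iter_addn /=.
have -> : d = (d - 3).+3 by lia.
move: (d - 3) => e; rewrite !addnS !addn0 !subSS !subn0.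
(* Weights 5 and 6 exceed [d.+1] when [d = 3], and weight 6 does when [d = 4];
   these two values have fewer terms than the general case. *)
by case: e => [|[|e]]; rewrite /= ?subSS ?subn0 !binS ?bin0; lia.
Qed.

Theorem corollary1p2 :
  (forall d n : nat, 3 <= d -> d + 3 <= n ->
     'C(n - 1, d) + 'C(n - 4, d - 2) + 'C(n - 6, d - 3) <= M d n)
  /\
  (forall d n : nat, 3 <= d -> 2 * d + 2 <= n ->
     'C(n - 1, d) + 'C(n - 4, d - 2) < M d n).
Proof.
have bound d n : 3 <= d -> d + 3 <= n ->
    'C(n - 1, d) + 'C(n - 4, d - 2) + 'C(n - 6, d - 3) <= M d n.
  move=> d3 dn; pose ps := take 6 (enum 'I_n).
  have ups : uniq ps by rewrite take_uniq ?enum_uniq.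
  have sps : size ps = 6 by rewrite size_takel // size_enum_ord; lia.
  have -> : n - 1 = n - 6 + 5 by lia.
  have -> : n - 4 = n - 6 + 2 by lia.
  rewrite -sum_six_point_patterns //.
  have := @card_family_ge _ ps ups six_point_patterns d.+1.
  rewrite card_ord sps => /(_ isT isT) /leq_trans; apply.
  apply: (leq_bigmax_cond (F := fun F : {set {set 'I_n}} => #|F|)).
  rewrite VCdim_family ?andbT //; last exact: six_point_patterns_deficient.
  by apply/subsetP => A; rewrite !inE => /andP[].
split=> // d n d3 dn.
apply: leq_trans (bound d n d3 _); last by lia.
by rewrite -[X in X < _]addn0 ltn_add2l bin_gt0; lia.
Qed.
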